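(* Suppose there exists a Kirkman frame on $v$ points of type $T$. Suppose that for some positive integer $w$, for each $t \in T$ there exists a Kirkman triple system of order $3t+w$ with a rainbow colouring $\phi$ that contains a rainbow subsystem on $w$ points (with respect to $\phi$). Then there exists a rainbow Kirkman triple system of order $3v+w$.
   Context: A $3$-GDD is a triple $(V,\mathcal{G},\mathcal{B})$ where $\mathcal{G}$ is a partition of $V$ into groups and $\mathcal{B}$ is a set of $3$-subsets (blocks) such that every pair of points in different groups lies in exactly one block and no block meets a group in more than one point. Its type is the multiset $T=\{|G| : G\in\mathcal{G}\}$. A Kirkman frame is a $3$-GDD together with a partition of $\mathcal{B}$ into partial parallel classes, each of which is a partition of $V\setminus G$ for some group $G$. A Kirkman triple system KTS$(n)$ is a Steiner triple system on $n$ points together with a partition of its triples into parallel classes (partitions of the point set). A $3$-colouring maps points to $3$ colours with no monochromatic triple. A colouring of a KTS$(n)$ is rainbow if it is a $3$-colouring with each colour class of size $n/3$ and some parallel class in which every triple receives all three colours; a KTS is rainbow if it admits a rainbow colouring. A subsystem of a KTS $(V,\mathcal{B})$ with resolution $\mathcal{R}$ is a KTS $(V',\mathcal{B}')$ with resolution $\mathcal{R}'$ such that $V'\subseteq V$, $\mathcal{B}'\subseteq\mathcal{B}$ and each class of $\mathcal{R}'$ is a subset of some class of $\mathcal{R}$. A rainbow subsystem with respect to a rainbow colouring $\phi$ is a subsystem which is rainbow under the restriction of $\phi$. *)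

(* Defs.v *)
From mathcomp Require Import all_boot.

Set Implicit Arguments.
Unset Strict Implicit.
Unset Printing Implicit Defensive.

(* Point sets are subsets X of an ambient finite type P, so that a system and
   its subsystems live over the same P, and restricting a colouring
   [phi : P -> 'I_3] to a subsystem just means evaluating the same predicate on
   the smaller point set.  MathComp's [partition] has no empty parts. *)

Definition triples_on (P : finType) (X : {set P}) (B : {set {set P}}) : Prop :=
  forall b, b \in B -> b \subset X /\ #|b| = 3.

Definition in_unique_block (P : finType) (B : {set {set P}}) (x y : P) : Prop :=
  exists! b : {set P}, b \in B /\ (x \in b /\ y \in b).

Definition GDD3 (P : finType) (X : {set P}) (G B : {set {set P}}) : Prop :=
  [/\ partition G X,
      triples_on X B,
      forall g h x y, g \in G -> h \in G -> g != h -> x \in g -> y \in h ->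
        in_unique_block B x y
    & forall b g, b \in B -> g \in G -> #|b :&: g| <= 1].

Definition group_type (P : finType) (G : {set {set P}}) : seq nat :=
  [seq #|g| | g : {set P} <- enum G].

Definition kirkman_frame (P : finType) (X : {set P}) (G B : {set {set P}})
    (R : {set {set {set P}}}) : Prop :=
  [/\ GDD3 X G B,
      partition R B
    & forall C, C \in R -> exists2 g, g \in G & partition C (X :\: g)].

Definition steiner_triple_system (P : finType) (X : {set P})
    (B : {set {set P}}) : Prop :=
  triples_on X B /\
  forall x y, x \in X -> y \in X -> x != y -> in_unique_block B x y.

Definition kirkman_triple_system (P : finType) (X : {set P})
    (B : {set {set P}}) (R : {set {set {set P}}}) : Prop :=
  [/\ steiner_triple_system X B,
      partition R B
    & forall C, C \in R -> partition C X].

Definition three_colouring (P : finType) (B : {set {set P}})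
    (phi : P -> 'I_3) : Prop :=
  forall b, b \in B -> ~ exists c, forall x, x \in b -> phi x = c.

Definition rainbow_triple (P : finType) (phi : P -> 'I_3) (b : {set P}) : Prop :=
  forall c, exists2 x, x \in b & phi x = c.

(* The factor 3 on the left makes "size n/3" exact (no truncated division). *)
Definition rainbow_colouring (P : finType) (X : {set P}) (B : {set {set P}})
    (R : {set {set {set P}}}) (phi : P -> 'I_3) : Prop :=
  [/\ three_colouring B phi,
      forall c, 3 * #|[set x in X | phi x == c]| = #|X|
    & exists2 C, C \in R & forall b, b \in C -> rainbow_triple phi b].

Definition KTS_subsystem (P : finType)
    (X' : {set P}) (B' : {set {set P}}) (R' : {set {set {set P}}})
    (X : {set P}) (B : {set {set P}}) (R : {set {set {set P}}}) : Prop :=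
  [/\ kirkman_triple_system X' B' R',
      X' \subset X,
      B' \subset B
    & forall C', C' \in R' -> exists2 C, C \in R & C' \subset C].

Definition has_rainbow_subsystem (P : finType) (X : {set P})
    (B : {set {set P}}) (R : {set {set {set P}}}) (phi : P -> 'I_3)
    (w : nat) : Prop :=
  exists X' B' R',
    [/\ KTS_subsystem X' B' R' X B R, #|X'| = w
      & rainbow_colouring X' B' R' phi].

(* Main.v *)
Require Import Defs.
From mathcomp Require Import all_boot zify.

Set Implicit Arguments.
Unset Strict Implicit.
Unset Printing Implicit Defensive.

(* Every frame point, and each of m = w / 3 new points, gets weight 3, the
   point (x, i) being coloured i.  A frame block b is replaced by the nine
   triples that have level i at two points of b and level i + 1 at the third
   one, z: none of them is monochromatic, and for fixed z they form a parallel
   class of b x Z_3.  The tripled frame is thus a properly coloured Kirkman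
   frame.  Writing U for the tripled new points, each group g together with U
   is filled with the given system by a colour-preserving bijection, and the
   copies of the subsystem on U are replaced by a single one.  No pair is joined
   twice, because there are only just enough classes to join every pair once.

   The rainbow class of the result is the union of a rainbow class of U and of
   the remainders of the rainbow classes of the fillings.  This needs the
   rainbow class of each filling to contain a class of its subsystem, which is
   not part of the hypotheses but follows by counting: a balanced 3-colouring of
   n points without monochromatic blocks has exactly n/3 rainbow blocks, so the
   rainbow class consists of all of them. *)

Section Partitions.
Variable P : finType.
Implicit Types (x y : P) (b X : {set P}) (D : {set {set P}}).

Lemma partition_exists_block D X x :
  partition D X -> x \in X -> exists2 b, b \in D & x \in b.
Proof.
by move=> DX; rewrite -(cover_partition DX) => /bigcupP[b]; exists b.
Qed.

Lemma trivIset_block_inj D x b b' :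
  trivIset D -> b \in D -> b' \in D -> x \in b -> x \in b' -> b = b'.
Proof.
move=> tD bD bD' xb xb'.
by rewrite -(def_pblock tD bD xb) (def_pblock tD bD' xb').
Qed.

Lemma partition_block_inj D X x b b' :
  partition D X -> b \in D -> b' \in D -> x \in b -> x \in b' -> b = b'.
Proof. by move=> /partition_trivIset; apply: trivIset_block_inj. Qed.

Lemma partition_mem D X b x : partition D X -> b \in D -> x \in b -> x \in X.
Proof. by move=> DX bD; apply/subsetP/(partitionS DX bD). Qed.

Lemma trivIset_of_block_inj D :
  (forall x b b', b \in D -> b' \in D -> x \in b -> x \in b' -> b = b') ->
  trivIset D.
Proof.
move=> inj; apply/trivIsetP => b b' bD bD'.
apply: contraR => /pred0Pn[x /andP[xb xb']].
by apply/eqP; apply: (inj x).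
Qed.

Lemma partitionU D D' X X' :
  partition D X -> partition D' X' -> [disjoint X & X'] ->
  partition (D :|: D') (X :|: X').
Proof.
move=> /and3P[/eqP <- tD D0] /and3P[/eqP <- tD' D'0] disj; apply/and3P; split.
- by rewrite /cover bigcup_setU.
- exact: trivIsetU.
- by rewrite inE negb_or D0.
Qed.

Lemma partitionD D D' X :
  partition D X -> D' \subset D -> partition (D :\: D') (X :\: cover D').
Proof.
move=> DX sD'; have [/eqP covD tD D0] := and3P DX; apply/and3P; split.
- rewrite -covD; apply/eqP/setP => x; apply/bigcupP/setDP => [[b]|[]].
    case/setDP=> bD bD' xb; split; first by apply/bigcupP; exists b.
    apply: contra bD' => /bigcupP[b' bD' xb'].
    by rewrite (trivIset_block_inj tD bD (subsetP sD' _ bD') xb xb').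
  case/bigcupP=> b bD xb xD'; exists b => //; rewrite inE bD andbT.
  by apply: contra xD' => bD'; apply/bigcupP; exists b.
- exact: trivIsetD.
- by rewrite inE (negbTE D0) andbF.
Qed.

Lemma partition_refine (G : {set {set P}}) X (D : {set P} -> {set {set P}}) :
  partition G X -> {in G, forall g, partition (D g) g} ->
  partition (\bigcup_(g in G) D g) X.
Proof.
move=> GX DG; apply/and3P; split.
- rewrite -(cover_partition GX); apply/eqP/setP => x.
  apply/bigcupP/bigcupP => [[b /bigcupP[g gG bg] xb]|[g gG xg]].
    by exists g; last exact: partition_mem (DG _ gG) bg xb.
  have [b bD xb] := partition_exists_block (DG _ gG) xg.
  by exists b => //; apply/bigcupP; exists g.
- apply: trivIset_of_block_inj => x b b' /bigcupP[g gG bg] /bigcupP[g' gG' bg'].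
  move=> xb xb'; have xg := partition_mem (DG _ gG) bg xb.
  have xg' := partition_mem (DG _ gG') bg' xb'.
  rewrite -(partition_block_inj GX gG gG' xg xg') in bg'.
  exact: partition_block_inj (DG _ gG) bg bg' xb xb'.
- by apply/bigcupP => -[g gG]; rewrite (partition0 (DG _ gG)).
Qed.

End Partitions.

Definition joined (P : finType) (D : {set {set P}}) (x y : P) : bool :=
  [exists b in D, (x \in b) && (y \in b)].

Section Joined.
Variable P : finType.
Implicit Types (x y : P) (B D : {set {set P}}).

Lemma joinedP D x y :
  reflect (exists b, [/\ b \in D, x \in b & y \in b]) (joined D x y).
Proof.
by apply: (iffP exists_inP) => [[b bD /andP[]]|[b [bD xb yb]]]; exists b;
  rewrite ?xb.
Qed.

Lemma joinedC D x y : joined D x y = joined D y x.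
Proof. by apply: eq_existsb => b; rewrite [(x \in b) && _]andbC. Qed.

Lemma joinedS D D' x y : D \subset D' -> joined D x y -> joined D' x y.
Proof.
by move=> /subsetP sD /joinedP[b [/sD bD' xb yb]]; apply/joinedP; exists b.
Qed.

Lemma joined_pblock D x y : trivIset D -> joined D x y = (y \in pblock D x).
Proof.
move=> tD; apply/joinedP/idP => [[b [bD xb yb]]|yx].
  by rewrite (def_pblock tD bD xb).
have xD : x \in cover D.
  apply: contraLR yx; rewrite -mem_pblock /pblock.
  by case: pickP => [b /andP[_ ->]|_]; rewrite ?inE.
by exists (pblock D x); rewrite pblock_mem ?mem_pblock.
Qed.

Lemma in_unique_blockP B x y :
  reflect (in_unique_block B x y)
          (#|[set b in B | (x \in b) && (y \in b)]| == 1).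
Proof.
apply: (iffP cards1P) => -[b].
  move=> /setP E; exists b; split=> [|b' [bB' [xb' yb']]].
    by have := E b; rewrite !inE eqxx => /and3P[-> -> ->].
  by have := E b'; rewrite !inE bB' xb' yb' => /esym/eqP.
case=> -[bB [xb yb]] uniq; exists b; apply/setP => b'; rewrite !inE.
apply/and3P/eqP => [[bB' xb' yb']|->]; last by [].
by rewrite (uniq b').
Qed.

End Joined.

Section Counting.
Variable P : finType.
Implicit Types (x y : P) (b S X : {set P}) (B : {set {set P}}).
Implicit Types (R : {set {set {set P}}}).

Lemma card_triple_setD1 b x : #|b| = 3 -> x \in b -> #|b :\ x| = 2.
Proof. by move=> b3 xb; have := cardsD1 x b; rewrite xb b3 => -[]. Qed.

Lemma card_neighbours B S x :
  {in B, forall b, #|b| = 3} -> x \notin S ->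
  {in S, forall y, in_unique_block B x y} ->
  {in B, forall b, x \in b -> b :\ x \subset S} ->
  #|S| = 2 * #|[set b in B | x \in b]|.
Proof.
move=> B3 xS uS subS; rewrite mulnC -sum_nat_const -sum1_card.
transitivity (\sum_(y in S) \sum_(b in B | (x \in b) && (y \in b)) 1).
  apply: eq_bigr => y /uS /in_unique_blockP/eqP one.
  by rewrite sum1dep_card one.
rewrite (exchange_big_dep [in [set b in B | x \in b]]) /=; last first.
  by move=> y b _ /and3P[bB xb _]; rewrite inE bB.
apply: eq_bigr => b; rewrite inE => /andP[bB xb].
rewrite -(card_triple_setD1 (B3 b bB) xb) -sum1_card; apply: eq_bigl => y.
rewrite !inE bB xb /=; apply/andP/andP => -[].
  by move=> yS yb; split=> //; apply: contraNneq xS => <-.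
by move=> yx yb; split=> //; apply: (subsetP (subS b bB xb)); rewrite !inE yx.
Qed.

Lemma card_blocks_through B R x :
  partition R B -> {in R, forall C, trivIset C} ->
  #|[set b in B | x \in b]| = #|[set C in R | x \in cover C]|.
Proof.
move=> RB tR; rewrite -!sum1dep_card (set_partition_big_cond R) //.
rewrite [RHS]big_mkcondr /=.
apply: eq_bigr => C CR; case: ifPn => [xC|/negP xC]; last first.
  by rewrite big1 // => b /andP[bC xb]; case: xC; apply/bigcupP; exists b.
rewrite (big_pred1 (pblock C x)) // => b /=.
apply/andP/eqP => [[bC xb]|->]; first by rewrite (def_pblock (tR C CR) bC xb).
by rewrite pblock_mem ?mem_pblock.
Qed.

Lemma card_KTS_classes X B R :
  kirkman_triple_system X B R -> X != set0 -> #|X| = (2 * #|R|).+1.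
Proof.
move=> [[tB uB] RB RX] /set0Pn[x xX]; rewrite (cardsD1 x) xX; congr _.+1.
rewrite (card_neighbours (B := B) (x := x)).
- rewrite (card_blocks_through _ RB) => [|C /RX/partition_trivIset //].
  congr (2 * #|pred_of_set _|); apply/setP => C; rewrite inE.
  by case CR: (C \in R) => //=; rewrite (cover_partition (RX _ CR)).
- by move=> b /tB[].
- by rewrite setD11.
- by move=> y /setD1P[yx yX]; apply: uB => //; rewrite eq_sym.
- by move=> b /tB[bX _] _; apply: setSD.
Qed.

(* Each class joins x to two points, so R makes at most |X| - 1 joins at x and
   cannot join x to a point twice. *)
Lemma card_classes_joining X R :
  {in R, forall C, partition C X} -> {in cover R, forall b, #|b| = 3} ->
  {in X &, forall x y, x != y -> exists2 C, C \in R & joined C x y} ->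
  2 * #|R| < #|X| ->
  {in X &, forall x y, x != y -> #|[set C in R | joined C x y]| = 1}.
Proof.
move=> RX R3 cov ltRX x y xX yX xy.
pose joining z := #|[set C in R | joined C x z]|.
have ge1 z : z \in X :\ x -> 1 <= joining z ?= iff (joining z == 1).
  case/setD1P=> zx zX; split; last by rewrite eq_sym.
  have [C CR xzC] : exists2 C, C \in R & joined C x z.
    by apply: cov; rewrite // eq_sym.
  by rewrite card_gt0; apply/set0Pn; exists C; rewrite inE CR.
have joins : \sum_(z in X :\ x) joining z = 2 * #|R|.
  under eq_bigr => z _ do rewrite /joining -sum1dep_card.
  rewrite (exchange_big_dep [in R]) /= => [|z C _ /andP[] //].
  rewrite mulnC -sum_nat_const; apply: eq_bigr => C CR.
  have CX := RX C CR; have xC : x \in cover C by rewrite (cover_partition CX).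
  have C3 : #|pblock C x| = 3.
    by apply: R3; apply/bigcupP; exists C; rewrite ?pblock_mem.
  rewrite -(card_triple_setD1 C3 (_ : x \in _)) ?mem_pblock // -sum1_card.
  have tC := partition_trivIset CX.
  apply: eq_bigl => z; rewrite !inE CR joined_pblock //.
  apply/andP/andP => [[/andP[]]|[-> zC]] //.
  by rewrite (partition_mem CX (pblock_mem xC) zC).
have [le] := leqif_sum ge1.
rewrite joins sum1_card.
have -> : (#|X :\ x| == 2 * #|R|).
  have := le; rewrite joins sum1_card eqn_leq => ->.
  by have := cardsD1 x X; rewrite xX; lia.
by move/esym/forall_inP => /(_ y); rewrite !inE eq_sym xy yX => /(_ isT)/eqP.
Qed.

Lemma KTS_of_classes X R :
  {in R, forall C, partition C X} -> {in cover R, forall b, #|b| = 3} ->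
  {in X &, forall x y, x != y -> exists2 C, C \in R & joined C x y} ->
  2 * #|R| < #|X| ->
  kirkman_triple_system X (cover R) R.
Proof.
move=> RX R3 cov ltRX; have one := card_classes_joining RX R3 cov ltRX.
have class_uniq C C' b b' x y : C \in R -> C' \in R -> x != y ->
    b \in C -> b' \in C' -> x \in b -> y \in b -> x \in b' -> y \in b' ->
    C = C'.
  move=> CR CR' xy bC bC' xb yb xb' yb'; have CX := RX C CR.
  have /eqP/cards1P[D /setP ED] :=
    one x y (partition_mem CX bC xb) (partition_mem CX bC yb) xy.
  have joinsD E c : E \in R -> c \in E -> x \in c -> y \in c -> E = D.
    move=> ER cE xc yc; apply/set1P; rewrite -ED inE ER.
    by apply/joinedP; exists c.
  by rewrite (joinsD C b) // (joinsD C' b').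
split=> //; first split.
- move=> b bR; split; last exact: R3.
  by case/bigcupP: bR => C /RX/partitionS; apply.
- move=> x y xX yX xy; have [C CR /joinedP[b [bC xb yb]]] := cov x y xX yX xy.
  exists b; split=> [|b' [/bigcupP[C' CR' bC'] [xb' yb']]].
    by split=> //; apply/bigcupP; exists C.
  have EC := class_uniq C C' b b' x y CR CR' xy bC bC' xb yb xb' yb'.
  by rewrite -EC in bC'; apply: partition_block_inj (RX C CR) bC bC' xb xb'.
- apply/and3P; split=> //.
    apply: trivIset_of_block_inj => b C C' CR CR' bC bC'.
    have /card_gt1P[x [y [xb yb xy]]] : 1 < #|b|.
      by rewrite R3 //; apply/bigcupP; exists C.
    exact: (class_uniq C C' b b x y).
  apply/negP => /RX /cover_partition; rewrite /cover big_set0 => X0.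
  by rewrite -X0 cards0 in ltRX.
Qed.

Lemma KTS_joined X B R x y :
  kirkman_triple_system X B R -> x \in X -> y \in X -> x != y ->
  exists2 C, C \in R & joined C x y.
Proof.
move=> [[_ uB] RB _] xX yX xy; have [b [[bB [xb yb]] _]] := uB x y xX yX xy.
have [C CR bC] := partition_exists_block RB bB.
by exists C => //; apply/joinedP; exists b.
Qed.

End Counting.

Definition hole (P : finType) (X : {set P}) (F : {set {set P}}) : {set P} :=
  X :\: cover F.

Definition hole_classes (P : finType) (X : {set P}) (R : {set {set {set P}}})
    (g : {set P}) : {set {set {set P}}} :=
  [set F in R | hole X F == g].

Section FrameCounting.
Variables (P : finType) (X : {set P}) (G B : {set {set P}}).
Variable R : {set {set {set P}}}.
Hypothesis frame : kirkman_frame X G B R.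

Lemma frame_hole F :
  F \in R -> hole X F \in G /\ partition F (X :\: hole X F).
Proof.
have [[GX _ _ _] _ RG] := frame; move=> /RG[g gG Fg].
suff -> : hole X F = g by [].
rewrite /hole (cover_partition Fg) setDDr setDv set0U.
exact/setIidPr/(partitionS GX).
Qed.

Lemma card_frame_classes_at g :
  g \in G -> 2 * #|R| + #|g| = #|X| + 2 * #|hole_classes X R g|.
Proof.
move=> gG; have [[GX tB uB gB] RB _] := frame.
have /set0Pn[x xg] := partition_neq0 GX gG.
have cardXg : #|X :\: g| = 2 * #|[set b in B | x \in b]|.
  apply: card_neighbours => [b /tB[] //||y /setDP[yX yg]|b bB xb].
  - by rewrite inE xg.
  - have [h hG yh] := partition_exists_block GX yX.
    by apply: (uB g h) => //; apply: contraNneq yg => ->.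
  - have bX := (tB b bB).1; apply/subsetP => y /setD1P[yx yb].
    rewrite inE (subsetP bX _ yb) andbT; apply/negP => yg.
    have := gB b g bB gG; rewrite leqNgt => /negP; apply.
    by apply/card_gt1P; exists x, y; rewrite !inE xb xg yb yg eq_sym.
have classes_at :
    [set F in R | x \in cover F] = R :\: hole_classes X R g.
  apply/setP => F; rewrite !inE; case FR: (F \in R); rewrite /= ?andbF // andbT.
  have [hG /cover_partition ->] := frame_hole FR.
  rewrite inE (partition_mem GX gG xg) andbT; congr (~~ _).
  apply/idP/eqP => [xh|->] //; exact: partition_block_inj GX hG gG xh xg.
rewrite (card_blocks_through _ RB) ?classes_at in cardXg; last first.
  by move=> F /frame_hole[_ /partition_trivIset].
have := cardsID g X; rewrite (setIidPr (partitionS GX gG)) cardXg => <-.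
have := cardsID (hole_classes X R g) R.
rewrite (setIidPr (_ : _ \subset R)) => [<-|]; first by lia.
by apply/subsetP => F /setIdP[].
Qed.

Lemma card_frame_classes : 1 < #|G| -> 2 * #|R| = #|X|.
Proof.
move=> G1; have [[GX _ _ _] _ _] := frame.
have sum_holes : \sum_(g in G) #|hole_classes X R g| = #|R|.
  rewrite -sum1_card (partition_big (hole X) [in G]) => [|F /frame_hole[] //].
  by apply: eq_bigr => g _; rewrite sum1dep_card.
have : \sum_(g in G) (2 * #|R| + #|g|) =
       \sum_(g in G) (#|X| + 2 * #|hole_classes X R g|).
  by apply: eq_bigr => g; apply: card_frame_classes_at.
rewrite !big_split /= sum_holes -(card_partition GX).
rewrite !sum_nat_const; move: G1; case: #|G| => [|[|k]] // _.
by move: #|R| #|X| => r x; nia.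
Qed.

Lemma card_frame_hole_classes :
  1 < #|G| -> {in G, forall g, 2 * #|hole_classes X R g| = #|g|}.
Proof. by move=> /card_frame_classes RX g /card_frame_classes_at; lia. Qed.

End FrameCounting.

Definition polychromatic (P : finType) (phi : P -> 'I_3) : {set {set P}} :=
  [set b : {set P} | 1 < #|phi @: b|].

Definition rainbow_sets (P : finType) (phi : P -> 'I_3) : {set {set P}} :=
  [set b : {set P} | phi @: b == [set: 'I_3]].

Section Colourings.
Variables (P : finType) (phi : P -> 'I_3).
Implicit Types (b X : {set P}) (B : {set {set P}}).

Lemma three_colouringP B :
  reflect (three_colouring B phi) (B \subset polychromatic phi).
Proof.
apply: (iffP subsetP) => [poly b /poly|col b /col notmono]; rewrite inE.
  case/card_gt1P=> _ [_ [/imsetP[x xb ->] /imsetP[y yb ->] xy]] [c mono].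
  by rewrite !mono ?eqxx in xy.
rewrite ltnNge; apply/negP => le1; apply: notmono.
have [->|/set0Pn[x xb]] := eqVneq b set0.
  by exists ord0 => x; rewrite inE.
exists (phi x) => y yb; move/card_le1_eqP: le1; apply; exact: imset_f.
Qed.

Lemma rainbow_tripleP b :
  reflect (rainbow_triple phi b) (b \in rainbow_sets phi).
Proof.
rewrite inE eqEsubset subsetT /=; apply: (iffP subsetP) => [rb c|rb c _].
  by have /imsetP[x xb ->] := rb c (in_setT c); exists x.
by have [x xb <-] := rb c; apply: imset_f.
Qed.

Lemma sum_card_colours X : \sum_c #|[set x in X | phi x == c]| = #|X|.
Proof.
rewrite -sum1_card (partition_big phi predT) //=.
by apply: eq_bigr => c _; rewrite sum1dep_card.
Qed.

Lemma card_imset_colours b :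
  #|phi @: b| = \sum_c (0 < #|[set x in b | phi x == c]|).
Proof.
rewrite -sum1_card big_mkcond; apply: eq_bigr => c _.
suff -> : (c \in phi @: b) = (0 < #|[set x in b | phi x == c]|) by case: ifP.
rewrite card_gt0; apply/imsetP/set0Pn => -[x].
  by move=> xb ->; exists x; rewrite inE xb eqxx.
by rewrite inE => /andP[xb /eqP <-]; exists x.
Qed.

Lemma card_monochromatic_pairs b :
  #|b| = 3 -> b \in polychromatic phi ->
  \sum_c 'C(#|[set x in b | phi x == c]|, 2) + (b \in rainbow_sets phi) = 1.
Proof.
rewrite !inE eqEcard subsetT cardsT card_ord card_imset_colours.
rewrite -(sum_card_colours b) !big_ord_recl !big_ord0.
by case: #|_| #|_| #|_| => [|[|[|[|i]]]] [|[|[|[|j]]]] [|[|[|[|k]]]] //=; lia.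
Qed.

End Colourings.

Lemma sum_pairs_in_blocks (P : finType) (X Y : {set P}) (B : {set {set P}}) :
  steiner_triple_system X B -> Y \subset X ->
  \sum_(b in B) 'C(#|b :&: Y|, 2) = 'C(#|Y|, 2).
Proof.
move=> [_ uB] /subsetP YX; rewrite -cards_draws -sum1dep_card.
under eq_bigr => b _ do rewrite -cards_draws -sum1dep_card.
rewrite (exchange_big_dep (fun A : {set P} => (A \subset Y) && (#|A| == 2))) /=;
  last by move=> b A _; rewrite subsetI -andbA => /and3P[_ -> ->].
apply: eq_bigr => A /andP[AY A2]; have /cards2P[x [y [xy EA]]] := A2.
have [xY yY] : x \in Y /\ y \in Y.
  by split; apply: (subsetP AY); rewrite EA !inE eqxx ?orbT.
have /in_unique_blockP/eqP one := uB x y (YX x xY) (YX y yY) xy.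
rewrite -[RHS]one -sum1dep_card; apply: eq_bigl => b.
by rewrite subsetI AY A2 !andbT EA subUset !sub1set.
Qed.

Definition balanced (P : finType) (phi : P -> 'I_3) (X : {set P}) : Prop :=
  forall c, 3 * #|[set x in X | phi x == c]| = #|X|.

(* Of the three pairs of points in a block, a bichromatic block has exactly one
   in a single colour and a rainbow block none; balance fixes the number of
   monochromatic pairs. *)
Lemma card_rainbow_blocks (P : finType) (phi : P -> 'I_3) (X : {set P}) B :
  steiner_triple_system X B -> three_colouring B phi -> balanced phi X ->
  3 * #|B :&: rainbow_sets phi| = #|X|.
Proof.
move=> sts /three_colouringP/subsetP poly bal.
pose m := #|[set x in X | phi x == ord0]|.
have Xm : #|X| = 3 * m by rewrite /m bal.
have triples : \sum_(b in B) 3 = 'C(3 * m, 2).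
  rewrite -Xm -(sum_pairs_in_blocks sts (subxx X)); apply: eq_bigr => b bB.
  by have [bX b3] := sts.1 b bB; rewrite (setIidPl bX) b3.
have mono :
    \sum_(b in B) \sum_c 'C(#|[set x in b | phi x == c]|, 2) = 3 * 'C(m, 2).
  rewrite exchange_big /=; transitivity (\sum_(c < 3) 'C(m, 2)); last first.
    by rewrite sum_nat_const card_ord.
  apply: eq_bigr => c _.
  have -> : m = #|[set x in X | phi x == c]| by have := bal c; lia.
  rewrite -(sum_pairs_in_blocks sts (_ : _ \subset X)); last first.
    by apply/subsetP => x /setIdP[].
  apply: eq_bigr => b bB; have [/subsetP bX _] := sts.1 b bB.
  congr 'C(#|pred_of_set _|, 2); apply/setP => x; rewrite !inE.
  by case xb: (x \in b); rewrite //= bX.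
have rainbow :
    \sum_(b in B) (b \in rainbow_sets phi) = #|B :&: rainbow_sets phi|.
  rewrite -sum1_card [RHS](eq_bigl _ _ (fun b => in_setI b B _)) big_mkcondr.
  by apply: eq_bigr => b _; case: ifP.
have blocks : #|B| = 3 * 'C(m, 2) + #|B :&: rainbow_sets phi|.
  rewrite -mono -rainbow -big_split /= -sum1_card; apply: eq_bigr => b bB.
  by rewrite card_monochromatic_pairs ?poly //; have [] := sts.1 b bB.
have bin2E n : 2 * 'C(n, 2) = n * n.-1 by rewrite -mul_bin_diag bin1.
have := bin2E (3 * m); have := bin2E m.
move: triples; rewrite sum_nat_const blocks Xm.
by case: m {Xm mono blocks} => [|m]; nia.
Qed.

Lemma rainbow_blocks_class (P : finType) (X : {set P}) (B : {set {set P}})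
    (R : {set {set {set P}}}) (phi : P -> 'I_3) :
  kirkman_triple_system X B R -> rainbow_colouring X B R phi ->
  B :&: rainbow_sets phi \in R.
Proof.
move=> [sts RB RX] [col bal [C CR rC]].
suff /eqP <- : C == B :&: rainbow_sets phi by [].
rewrite eqEcard subsetI (partitionS RB CR) /=; apply/andP; split.
  by apply/subsetP => b /rC/rainbow_tripleP.
have cardX : #|X| = #|C| * 3.
  apply: card_uniform_partition (RX C CR) => b bC.
  by have [] := sts.1 b (partition_mem RB CR bC).
rewrite -(leq_pmul2l (isT : 0 < 3)) (card_rainbow_blocks sts col bal).
by rewrite cardX mulnC.
Qed.

Section Balance.
Variables (P : finType) (phi : P -> 'I_3).
Implicit Types X Y : {set P}.

Lemma balancedU X Y :
  [disjoint X & Y] -> balanced phi X -> balanced phi Y ->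
  balanced phi (X :|: Y).
Proof.
move=> XY bX bY c.
have -> : [set x in X :|: Y | phi x == c] =
          [set x in X | phi x == c] :|: [set x in Y | phi x == c].
  by apply/setP => x; rewrite !inE andb_orl.
rewrite !cardsU !disjoint_setI0 ?cards0 ?subn0 ?mulnDr ?bX ?bY //.
by apply: disjointW XY; apply/subsetP => x /setIdP[].
Qed.

Lemma balancedD X Y :
  Y \subset X -> balanced phi X -> balanced phi Y -> balanced phi (X :\: Y).
Proof.
move=> YX bX bY c.
have -> : [set x in X :\: Y | phi x == c] =
          [set x in X | phi x == c] :\: [set x in Y | phi x == c].
  apply/setP => x; rewrite !inE.
  by case: (x \in X) (x \in Y) (_ == c) => [] [] [].
rewrite !cardsDS ?mulnBr ?bX ?bY //; apply/subsetP => x.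
by rewrite !inE => /andP[xY ->]; rewrite (subsetP YX _ xY).
Qed.

Lemma balanced_partition (G : {set {set P}}) X :
  partition G X -> {in G, forall g, balanced phi g} -> balanced phi X.
Proof.
move=> GX bG c; rewrite -sum1dep_card (set_partition_big_cond G) //.
rewrite big_distrr (card_partition GX) /=; apply: eq_bigr => g gG.
by rewrite sum1dep_card bG.
Qed.

End Balance.

Section Bijections.
Variables (S T : finType) (y0 : T).
Implicit Types (A : {set S}) (B : {set T}).

Lemma exists_bijection_in A B :
  #|A| = #|B| -> exists f : S -> T, {in A &, injective f} /\ f @: A = B.
Proof.
move=> eqAB; pose f x := nth y0 (enum B) (index x (enum A)).
have idx x : x \in A -> index x (enum A) < size (enum B).
  by move=> xA; rewrite -cardE -eqAB cardE index_mem mem_enum.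
have inj : {in A &, injective f}.
  move=> x y xA yA /eqP; rewrite nth_uniq ?enum_uniq ?idx // => /eqP.
  by apply: (index_inj x); rewrite mem_enum.
exists f; split=> //; apply/eqP.
rewrite eqEcard card_in_imset // eqAB leqnn andbT.
by apply/subsetP => _ /imsetP[x xA ->]; rewrite -mem_enum mem_nth ?idx.
Qed.

Lemma exists_colour_bijection_in (K : finType) (col : S -> K) (col' : T -> K)
    A B :
  (forall c, #|[set x in A | col x == c]| = #|[set y in B | col' y == c]|) ->
  exists f : S -> T, [/\ {in A &, injective f}, f @: A = B
    & {in A, forall x, col' (f x) = col x}].
Proof.
move=> eq_card.
have [F /all_and2[injF imF]] :=
  fin_all_exists (fun c => exists_bijection_in (eq_card c)).
have Fcol x : x \in A -> F (col x) x \in [set y in B | col' y == col x].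
  by move=> xA; rewrite -imF; apply: imset_f; rewrite inE xA eqxx.
exists (fun x => F (col x) x); split=> [x y xA yA eqF||x /Fcol]; last first.
- by rewrite inE => /andP[_ /eqP].
- apply/setP => y; apply/imsetP/idP => [[x /Fcol + ->]|yB].
    by rewrite inE => /andP[].
  have : y \in [set z in B | col' z == col' y] by rewrite inE yB eqxx.
  rewrite -imF => /imsetP[x /setIdP[xA /eqP xy] ->].
  by exists x; rewrite ?xy.
have eqxy : col x = col y.
  have := Fcol _ xA; have := Fcol _ yA.
  by rewrite -eqF !inE => /andP[_ /eqP <-] /andP[_ /eqP].
by move: eqF; rewrite eqxy; apply: injF; rewrite inE ?xA ?yA ?eqxy /=.
Qed.

Lemma exists_pointed_bijection_in A B a b :
  #|A| = #|B| -> a \in A -> b \in B ->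
  exists f : S -> T, [/\ {in A &, injective f}, f @: A = B & f a = b].
Proof.
move=> eqAB aA bB.
have card_marked (U : finType) (D : {set U}) u c :
    u \in D -> #|[set v in D | (v == u) == c]| = if c then 1 else #|D|.-1.
  move=> uD; case: c.
    rewrite -(cards1 u); apply: eq_card => v; rewrite !inE eqb_id.
    by case: eqVneq => [->|]; rewrite ?uD ?andbF.
  rewrite (cardsD1 u D) uD; apply: eq_card => v.
  by rewrite !inE eqbF_neg andbC.
have [c|f [injf imf marked]] :=
  @exists_colour_bijection_in bool (eq_op^~ a) (eq_op^~ b) A B.
  by rewrite !card_marked ?eqAB.
by exists f; split=> //; apply/eqP; rewrite marked ?eqxx.
Qed.

End Bijections.

Definition extension (P : finType) (R : {set {set {set P}}})
    (D : {set {set P}}) : {set {set P}} :=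
  odflt set0 [pick C in R | D \subset C].

Section Subsystems.
Variables (P : finType) (X X' : {set P}) (B B' : {set {set P}}).
Variables R R' : {set {set {set P}}}.
Hypothesis kts : kirkman_triple_system X B R.
Hypothesis sub : KTS_subsystem X' B' R' X B R.
Hypothesis X'0 : X' != set0.

Lemma extensionP D : D \in R' -> extension R D \in R /\ D \subset extension R D.
Proof.
have [_ _ _ ext] := sub; move=> /ext[C CR DC]; rewrite /extension.
by case: pickP => [E /andP[]|/(_ C)] //; rewrite CR DC.
Qed.

Lemma extension_inj : {in R' &, injective (extension R)}.
Proof.
have [_ RB RX] := kts; have [[_ RB' RX'] _ _ _] := sub.
move=> D E DR ER eqDE; have /set0Pn[x xX'] := X'0.
have [b bD xb] := partition_exists_block (RX' D DR) xX'.
have [c cE xc] := partition_exists_block (RX' E ER) xX'.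
have [extDR sD] := extensionP DR; have [_ sE] := extensionP ER.
have bc : b = c.
  apply: (partition_block_inj (RX _ extDR) _ _ xb xc).
    exact: (subsetP sD).
  by rewrite eqDE; apply: (subsetP sE).
by apply: (partition_block_inj RB' DR ER bD); rewrite bc.
Qed.

Lemma card_nonextension_classes :
  2 * #|R :\: extension R @: R'| = #|X :\: X'|.
Proof.
have [kts' X'X _ _] := sub.
have /set0Pn[x xX'] := X'0.
have X0 : X != set0 by apply/set0Pn; exists x; apply: (subsetP X'X).
have extR : extension R @: R' \subset R.
  by apply/subsetP => _ /imsetP[D /extensionP[DR _] ->].
rewrite !cardsDS // card_in_imset; last exact: extension_inj.
by rewrite (card_KTS_classes kts X0) (card_KTS_classes kts' X'0) subSS mulnBr.
Qed.

Lemma partition_extensionD D :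
  D \in R' -> partition (extension R D :\: D) (X :\: X').
Proof.
have [_ _ RX] := kts; have [[_ _ RX'] _ _ _] := sub; move=> DR.
have [/RX ext sD] := extensionP DR.
by rewrite -(cover_partition (RX' D DR)); apply: partitionD.
Qed.

Lemma subsystem_joined x y :
  x \in X :\: X' -> y \in X -> x != y ->
  (exists2 C, C \in R :\: extension R @: R' & joined C x y) \/
  (exists2 D, D \in R' & joined (extension R D :\: D) x y).
Proof.
have [[_ _ RX'] _ _ _] := sub.
move=> /setDP[xX xX'] yX xy; have [C CR Cxy] := KTS_joined kts xX yX xy.
have [/imsetP[D DR E]|CnR] := boolP (C \in extension R @: R'); last first.
  by left; exists C; rewrite // inE CnR.
right; exists D => //; rewrite E in Cxy; have /joinedP[b [bC xb yb]] := Cxy.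
apply/joinedP; exists b; rewrite inE bC andbT; split=> //.
by apply: contra xX' => bD; apply: partition_mem (RX' D DR) bD xb.
Qed.

Lemma extension_rainbow phi :
  rainbow_colouring X B R phi -> rainbow_colouring X' B' R' phi ->
  extension R (B' :&: rainbow_sets phi) = B :&: rainbow_sets phi.
Proof.
move=> rbw rbw'; have [_ RB _] := kts; have [kts' _ B'B _] := sub.
have CR := rainbow_blocks_class kts rbw.
have CR' := rainbow_blocks_class kts' rbw'.
have [_ RB' _] := kts'; have [eR sC] := extensionP CR'.
have /set0Pn[b bC] := partition_neq0 RB' CR'.
apply: (partition_block_inj RB eR CR (subsetP sC b bC)).
by move: bC; rewrite !inE => /andP[/(subsetP B'B) ->].
Qed.

End Subsystems.

Definition parallel_class (P : finType) (T : {set {set P}}) (X : {set P})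
    (D : {set {set P}}) : bool :=
  partition D X && (D \subset T).

Definition proper_triples (P : finType) (phi : P -> 'I_3) : {set {set P}} :=
  [set b in polychromatic phi | #|b| == 3].

Lemma blocks_proper_triples (P : finType) (phi : P -> 'I_3) (X : {set P}) B :
  triples_on X B -> three_colouring B phi -> B \subset proper_triples phi.
Proof.
move=> tB /three_colouringP/subsetP poly; apply/subsetP => b bB.
by rewrite inE poly //; have [_ ->] := tB b bB.
Qed.

(* What remains of a resolved system on X :|: U when a subsystem on U is deleted
   from it. *)
Definition hole_filling (P : finType) (T : {set {set P}}) (X U : {set P})
    (A R0 : {set {set {set P}}}) (n m : {set {set P}} -> {set {set P}}) :
    Prop :=
  [/\ {in A, forall F, parallel_class T (X :|: U) (n F)},
      {in R0, forall D, parallel_class T X (m D)}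
    & forall x y, x \in X -> y \in X :|: U -> x != y ->
        (exists2 F, F \in A & joined (n F) x y) \/
        (exists2 D, D \in R0 & joined (m D) x y)].

Definition has_rainbow_KTS (P : finType) (phi : P -> 'I_3) (X : {set P}) :
    Prop :=
  exists B R, kirkman_triple_system X B R /\ rainbow_colouring X B R phi.

Definition rainbow_KTS_containing (P : finType) (phi : P -> 'I_3)
    (X U : {set P}) : Prop :=
  exists B R B' R',
    [/\ kirkman_triple_system X B R, rainbow_colouring X B R phi,
        KTS_subsystem U B' R' X B R & rainbow_colouring U B' R' phi].

Lemma exists_hole_filling (P : finType) (phi : P -> 'I_3) (X U : {set P})
    (A R0 : {set {set {set P}}}) C0 :
  [disjoint X & U] -> U != set0 -> rainbow_KTS_containing phi (X :|: U) U ->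
  2 * #|A| = #|X| -> #|U| = (2 * #|R0|).+1 -> C0 \in R0 ->
  exists n m, hole_filling (proper_triples phi) X U A R0 n m /\
    m C0 \subset rainbow_sets phi.
Proof.
move=> XU U0 [B [R [B' [R' [kts rbw sub rbw']]]]] cardA cardU C0R0.
have [sts RB RX] := kts; have [kts' _ _ _] := sub.
have XUD : (X :|: U) :\: U = X by rewrite setDUl setDv setU0; apply/setDidPl.
have proper C : C \in R -> C \subset proper_triples phi.
  move=> CR; apply: subset_trans (partitionS RB CR) _.
  by apply: blocks_proper_triples sts.1 _; case: rbw.
have cardR : #|A| = #|R :\: extension R @: R'|.
  have := card_nonextension_classes kts sub U0; rewrite XUD -cardA.
  by move/eqP; rewrite eqn_mul2l => /eqP.
have cardR' : #|R0| = #|R'|.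
  move: cardU; rewrite (card_KTS_classes kts' U0) => -[].
  by move/eqP; rewrite eqn_mul2l => /eqP.
have [n [_ nA]] := exists_bijection_in set0 cardR.
have [m [_ mR0 mC0]] := exists_pointed_bijection_in set0 cardR' C0R0
  (rainbow_blocks_class kts' rbw').
have mR' D : D \in R0 -> m D \in R' by move=> DR0; rewrite -mR0 imset_f.
exists n, (fun D => extension R (m D) :\: m D); split; last first.
  rewrite mC0 (extension_rainbow kts sub rbw rbw') subDset.
  by rewrite subsetU // subsetIr orbT.
split=> [F FA|D /mR' DR'|x y xX yX xy].
- have : n F \in n @: A by rewrite imset_f.
  by rewrite nA inE => /andP[_ FR]; rewrite /parallel_class RX // proper.
- apply/andP; split.
    by have := partition_extensionD kts sub DR'; rewrite XUD.
  exact: subset_trans (subsetDl _ _) (proper _ (extensionP sub DR').1).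
- have xXUD : x \in (X :|: U) :\: U by rewrite XUD.
  have [[C]|[D]] := subsystem_joined kts sub xXUD yX xy.
    by rewrite -nA => /imsetP[F FA ->]; left; exists F.
  by rewrite -mR0 => /imsetP[E ER0 ->]; right; exists E.
Qed.

Section FillHoles.
Variables (P : finType) (T : {set {set P}}) (U : {set P}).
Variables (G B B0 : {set {set P}}) (R R0 : {set {set {set P}}}).
Variables n m : {set P} -> {set {set P}} -> {set {set P}}.
Hypothesis frame : kirkman_frame (~: U) G B R.
Hypothesis base : kirkman_triple_system U B0 R0.
Hypotheses (sBT : B \subset T) (sB0T : B0 \subset T).
Hypothesis T3 : {in T, forall b : {set P}, #|b| = 3}.
Hypothesis filling : {in G, forall g, hole_filling T g U
  (hole_classes (~: U) R g) R0 (n g) (m g)}.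

Definition filled_frame_class (F : {set {set P}}) : {set {set P}} :=
  F :|: n (hole (~: U) F) F.

Definition filled_base_class (D : {set {set P}}) : {set {set P}} :=
  D :|: \bigcup_(g in G) m g D.

Definition filled_classes : {set {set {set P}}} :=
  filled_frame_class @: R :|: filled_base_class @: R0.

Lemma filled_frame_class_parallel F :
  F \in R -> parallel_class T setT (filled_frame_class F).
Proof.
have [_ RB _] := frame.
move=> FR; have [gG Fpart] := frame_hole frame FR.
have [/(_ F) + _ _] := filling gG.
rewrite inE FR eqxx => /(_ isT)/andP[npart nT].
rewrite /filled_frame_class.
move: (hole _ F) Fpart npart nT {gG} => g Fpart npart nT.
apply/andP; split; last by rewrite subUset nT (subset_trans (partitionS RB FR)).
have -> : [set: P] = (~: U :\: g) :|: (g :|: U).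
  by apply/setP => x; rewrite !inE; case: (x \in g); case: (x \in U).
apply: partitionU => //; rewrite -setI_eq0; apply/eqP/setP => x; rewrite !inE.
by case: (x \in g); case: (x \in U).
Qed.

Lemma filled_base_class_parallel D :
  D \in R0 -> parallel_class T setT (filled_base_class D).
Proof.
have [[GU _ _ _] _ _] := frame; have [_ RB0 RU] := base.
move=> DR0; have mD g : g \in G -> parallel_class T g (m g D).
  by move=> /filling[_ + _]; apply.
apply/andP; split; last first.
  rewrite subUset (subset_trans (partitionS RB0 DR0)) //=.
  by apply/bigcupsP => g /mD/andP[].
rewrite -(setUCr U); apply: partitionU; first exact: RU.
- by apply: partition_refine => // g /mD/andP[].
- by rewrite -setI_eq0 setICr.
Qed.

Lemma filled_classes_parallel :
  {in filled_classes, forall C, parallel_class T setT C}.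
Proof.
by move=> _ /setUP[] /imsetP[C CR ->];
  [apply: filled_frame_class_parallel|apply: filled_base_class_parallel].
Qed.

Lemma filled_classes_join_group g x y :
  g \in G -> x \in g -> y \in g :|: U -> x != y ->
  exists2 C, C \in filled_classes & joined C x y.
Proof.
move=> gG xg yg xy; have [_ _ /(_ x y xg yg xy)] := filling gG.
case=> -[E]; [rewrite inE => /andP[ER /eqP hE]|move=> ER] => Exy.
  exists (filled_frame_class E); first by rewrite inE imset_f.
  by apply: joinedS Exy; rewrite /filled_frame_class hE subsetUr.
exists (filled_base_class E); first by rewrite inE imset_f ?orbT.
by apply: joinedS Exy; apply: subsetU; rewrite (bigcup_max g) ?orbT.
Qed.

Lemma filled_classes_join x y :
  x != y -> exists2 C, C \in filled_classes & joined C x y.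
Proof.
have [[GU _ uB _] RB _] := frame.
have groupE z := partition_exists_block GU (x := z).
move=> xy; have [xU|xU] := boolP (x \in U); have [yU|yU] := boolP (y \in U).
- have [D DR0 Dxy] := KTS_joined base xU yU xy.
  exists (filled_base_class D); first by rewrite inE imset_f ?orbT.
  by apply: joinedS Dxy; apply: subsetUl.
- have [g gG yg] : exists2 g, g \in G & y \in g by apply: groupE; rewrite inE.
  have xg : x \in g :|: U by rewrite inE xU orbT.
  rewrite eq_sym in xy.
  have [C CF Cyx] := filled_classes_join_group gG yg xg xy.
  by exists C; rewrite // joinedC.
- have [g gG xg] : exists2 g, g \in G & x \in g by apply: groupE; rewrite inE.
  by apply: (filled_classes_join_group gG); rewrite // inE yU orbT.
have [g gG xg] : exists2 g, g \in G & x \in g by apply: groupE; rewrite inE.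
have [h hG yh] : exists2 h, h \in G & y \in h by apply: groupE; rewrite inE.
have [gh|gh] := eqVneq g h.
  by apply: (filled_classes_join_group gG); rewrite // inE gh yh.
have [b [[bB [xb yb]] _]] := uB g h x y gG hG gh xg yh.
have [F FR bF] := partition_exists_block RB bB.
exists (filled_frame_class F); first by rewrite inE imset_f.
by apply/joinedP; exists b; rewrite inE bF.
Qed.

Lemma card_filled_classes :
  U != set0 -> 1 < #|G| -> 2 * #|filled_classes| < #|P|.
Proof.
move=> U0 G1; rewrite -(cardsC U) (card_KTS_classes base U0).
rewrite -(card_frame_classes frame G1) addSn ltnS -mulnDr leq_mul2l /= addnC.
by apply: leq_trans (leq_card_setU _ _).1 (leq_add _ _); apply: leq_imset_card.
Qed.

Lemma filled_KTS :
  U != set0 -> 1 < #|G| ->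
  kirkman_triple_system setT (cover filled_classes) filled_classes.
Proof.
move=> U0 G1; apply: KTS_of_classes.
- by move=> C /filled_classes_parallel/andP[].
- move=> b /bigcupP[C /filled_classes_parallel/andP[_ /subsetP sCT]].
  by move/sCT; apply: T3.
- by move=> x y _ _; apply: filled_classes_join.
- by rewrite cardsT; apply: card_filled_classes.
Qed.

End FillHoles.

Lemma rainbow_filled_KTS (P : finType) (phi : P -> 'I_3) (U : {set P})
    (G B B0 : {set {set P}}) (R R0 : {set {set {set P}}}) n m :
  kirkman_frame (~: U) G B R -> three_colouring B phi -> 1 < #|G| ->
  kirkman_triple_system U B0 R0 -> rainbow_colouring U B0 R0 phi -> U != set0 ->
  balanced phi (~: U) ->
  {in G, forall g, hole_filling (proper_triples phi) g U
     (hole_classes (~: U) R g) R0 (n g) (m g) /\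
     m g (B0 :&: rainbow_sets phi) \subset rainbow_sets phi} ->
  has_rainbow_KTS phi [set: P].
Proof.
move=> frame col G1 base rbw0 U0 bal filling.
have [col0 bal0 _] := rbw0; have [[_ tB _ _] _ _] := frame.
have [[tB0 _] _ _] := base.
have sBT := blocks_proper_triples tB col.
have sB0T := blocks_proper_triples tB0 col0.
have T3 : {in proper_triples phi, forall b : {set P}, #|b| = 3}.
  by move=> b; rewrite inE => /andP[_ /eqP].
have fill := filled_classes_parallel frame base sBT sB0T
  (fun g gG => (filling g gG).1).
set R1 := filled_classes U G R R0 n m in fill.
exists (cover R1), R1; split.
  by apply: (filled_KTS frame base sBT sB0T T3) => // g /filling[].
split.
- apply/three_colouringP/bigcupsP => C /fill/andP[_ CT].
  by apply: subset_trans CT _; apply/subsetP => b; rewrite inE => /andP[].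
- rewrite -(setUCr U); apply: balancedU => //.
  by rewrite -setI_eq0 setICr.
- exists (filled_base_class G m (B0 :&: rainbow_sets phi)).
    by rewrite inE imset_f ?orbT //; apply: rainbow_blocks_class base rbw0.
  move=> b bC; apply/rainbow_tripleP; apply: subsetP bC.
  rewrite subUset subsetIr /=.
  by apply/bigcupsP => g /filling[].
Qed.

Lemma fill_kirkman_frame (P : finType) (phi : P -> 'I_3) (U : {set P})
    (G B : {set {set P}}) (R : {set {set {set P}}}) :
  kirkman_frame (~: U) G B R -> three_colouring B phi ->
  U != set0 -> G != set0 ->
  {in G, forall g, rainbow_KTS_containing phi (g :|: U) U} ->
  has_rainbow_KTS phi [set: P].
Proof.
move=> frame col U0 /set0Pn[g0 g0G] fills; have [[GU _ _ _] _ _] := frame.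
have [B0' [R0' [B0 [R0 [kts0' rbw0' [base _ _ _] rbw0]]]]] := fills g0 g0G.
(* A single group is all of ~: U, so its filling is already a system on P; the
   numbers of frame classes are only determined for two groups or more. *)
have [G1|] := ltnP 1 #|G|; last first.
  move=> /card_le1_eqP G1; have EG : G = [set g0].
    by apply/setP => g; rewrite inE; apply/idP/eqP => [gG|->//]; apply: G1.
  have Eg0 : g0 = ~: U by rewrite -(cover_partition GU) EG cover1.
  by exists B0', R0'; rewrite -(setUCr U) setUC -Eg0.
have disj g : g \in G -> [disjoint g & U].
  by move=> gG; rewrite disjoints_subset (partitionS GU).
have /fin_all_exists[n /fin_all_exists[m filling]] :
    forall g, exists n m, g \in G ->
    hole_filling (proper_triples phi) g U
      (hole_classes (~: U) R g) R0 n m /\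
    m (B0 :&: rainbow_sets phi) \subset rainbow_sets phi.
  move=> g; have [gG|_] := boolP (g \in G); last by exists id, id.
  have [n [m nmP]] := exists_hole_filling (disj g gG) U0 (fills g gG)
    (card_frame_hole_classes frame G1 gG) (card_KTS_classes base U0)
    (rainbow_blocks_class base rbw0).
  by exists n, m.
apply: (rainbow_filled_KTS frame col G1 base rbw0 U0) filling.
apply: balanced_partition GU _ => g gG.
have [? [? [? [? [_ [_ balY _] _ [_ balU _]]]]]] := fills g gG.
have -> : g = (g :|: U) :\: U.
  by rewrite setDUl setDv setU0; apply/esym/setDidPl/disj.
by apply: balancedD; rewrite ?subsetUr.
Qed.

(* f @: _ as a function, so that it can be mapped over blocks and classes. *)
Definition set_image (P Q : finType) (f : P -> Q) (A : {set P}) : {set Q} :=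
  f @: A.

Section InjectiveImages.
Variables (P Q : finType) (f : P -> Q).
Hypothesis injf : injective f.
Implicit Types (X U : {set P}) (B : {set {set P}}).

Lemma partition_image B X :
  partition B X -> partition (set_image f @: B) (f @: X).
Proof. by move=> BX; have := imset_partition B X injf; rewrite BX. Qed.

Lemma triples_on_image X B :
  triples_on X B -> triples_on (f @: X) (set_image f @: B).
Proof.
by move=> tB _ /imsetP[b /tB[bX b3] ->]; rewrite imsetS // card_imset.
Qed.

Lemma in_unique_block_image B x y :
  in_unique_block B x y -> in_unique_block (set_image f @: B) (f x) (f y).
Proof.
case=> b [[bB [xb yb]] uniq]; exists (f @: b); split; first by rewrite !imset_f.
move=> c [/imsetP[b' bB' ->]].
by rewrite !mem_imset // => -[xb' yb']; rewrite (uniq b').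
Qed.

Lemma imsetD_inj X U : f @: (X :\: U) = f @: X :\: f @: U.
Proof.
apply/setP => y; rewrite inE; apply/imsetP/andP => [[x /setDP[xX xU] ->]|[yU]].
  by rewrite !mem_imset.
case/imsetP=> x xX E; exists x => //.
by rewrite inE xX -(mem_imset U x injf) -E yU.
Qed.

End InjectiveImages.

Section Transport.
Variables (P Q : finType) (f : P -> Q).
Hypothesis injf : injective f.
Implicit Types (X U : {set P}) (G B : {set {set P}}) (R : {set {set {set P}}}).

Local Notation image_blocks B := (set_image f @: B).
Local Notation image_classes R := (set_image (set_image f) @: R).

Lemma KTS_image X B R :
  kirkman_triple_system X B R ->
  kirkman_triple_system (f @: X) (image_blocks B) (image_classes R).
Proof.
case=> -[tB uB] RB RX; split; first split; first exact: triples_on_image.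
- move=> _ _ /imsetP[x xX ->] /imsetP[y yX ->]; rewrite (inj_eq injf) => xy.
  exact/in_unique_block_image/uB.
- exact: (partition_image (imset_inj injf)).
- by move=> _ /imsetP[C /RX CX ->]; apply: partition_image.
Qed.

Lemma kirkman_frame_image X G B R :
  kirkman_frame X G B R ->
  kirkman_frame (f @: X) (image_blocks G) (image_blocks B) (image_classes R).
Proof.
case=> -[GX tB uB gB] RB RG; split; first split.
- exact: partition_image.
- exact: triples_on_image.
- move=> _ _ x' y' /imsetP[g gG ->] /imsetP[h hG ->] gh.
  move=> /imsetP[x xg ->] /imsetP[y yh ->].
  apply/in_unique_block_image/(uB g h) => //.
  by apply: contra_neq gh => ->.
- move=> _ _ /imsetP[b bB ->] /imsetP[g gG ->].
  by rewrite -imsetI => [|? ? _ _ /injf] //; rewrite card_imset // gB.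
- exact: (partition_image (imset_inj injf)).
- move=> _ /imsetP[C /RG[g gG CX] ->]; exists (f @: g); first exact: imset_f.
  by rewrite -imsetD_inj //; apply: partition_image.
Qed.

Lemma KTS_subsystem_image X B R X' B' R' :
  KTS_subsystem X' B' R' X B R ->
  KTS_subsystem (f @: X') (image_blocks B') (image_classes R')
                (f @: X) (image_blocks B) (image_classes R).
Proof.
case=> kts' X'X B'B ext; split; [exact: KTS_image|exact: imsetS|exact: imsetS|].
move=> _ /imsetP[D /ext[C CR DC] ->].
by exists (image_blocks C); rewrite ?imset_f ?imsetS.
Qed.

Lemma rainbow_colouring_image X B R (phi : P -> 'I_3) (psi : Q -> 'I_3) :
  psi \o f =1 phi -> rainbow_colouring X B R phi ->
  rainbow_colouring (f @: X) (image_blocks B) (image_classes R) psi.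
Proof.
move=> fcol [/three_colouringP/subsetP col bal [C CR rC]].
have psi_image (b : {set P}) : psi @: (f @: b) = phi @: b.
  by rewrite -imset_comp; apply: eq_imset.
split.
- apply/three_colouringP/subsetP => _ /imsetP[b /col + ->].
  by rewrite !inE psi_image.
- move=> c; rewrite card_imset // -(bal c) -(card_imset _ injf).
  congr (3 * #|pred_of_set _|); apply/setP => y; rewrite inE.
  apply/andP/imsetP => [[/imsetP[x xX ->] cx]|[x]].
    by exists x; rewrite // inE xX -fcol.
  by rewrite inE -fcol => /andP[xX cx] ->; rewrite imset_f.
- exists (image_blocks C); first exact: imset_f.
  move=> _ /imsetP[b /rC/rainbow_tripleP rb ->]; apply/rainbow_tripleP.
  by move: rb; rewrite !inE psi_image.
Qed.

Lemma rainbow_KTS_containing_image X U (phi : P -> 'I_3) (psi : Q -> 'I_3) :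
  psi \o f =1 phi -> rainbow_KTS_containing phi X U ->
  rainbow_KTS_containing psi (f @: X) (f @: U).
Proof.
move=> fcol [B [R [B' [R' [kts rbw sub rbw']]]]].
exists (image_blocks B), (image_classes R).
exists (image_blocks B'), (image_classes R').
by split; [exact: KTS_image|exact: rainbow_colouring_image rbw
  |exact: KTS_subsystem_image|exact: rainbow_colouring_image rbw'].
Qed.

End Transport.

Lemma exists_balanced_bijection (P Q : finType) (phi : P -> 'I_3)
    (psi : Q -> 'I_3) (A A' : {set P}) (B B' : {set Q}) (q0 : Q) :
  A' \subset A -> B' \subset B -> #|A| = #|B| -> #|A'| = #|B'| ->
  balanced phi A -> balanced phi A' -> balanced psi B -> balanced psi B' ->
  exists f : P -> Q, [/\ {in A &, injective f}, f @: A = B, f @: A' = B'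
    & {in A, forall x, psi (f x) = phi x}].
Proof.
move=> A'A B'B eqAB eqAB' balA balA' balB balB'.
have fibre (T : finType) (chi : T -> 'I_3) (D E : {set T}) c s : E \subset D ->
    [set x in D | (chi x, x \in E) == (c, s)] =
    [set x in (if s then E else D :\: E) | chi x == c].
  move=> /subsetP ED; apply/setP => x; rewrite !inE xpair_eqE.
  by case: s; rewrite ?inE; case xE: (x \in E);
    rewrite ?(ED x xE) /= ?andbT ?andbF.
have [[c s]|f [injf fA fcol]] := @exists_colour_bijection_in _ _ q0 _
    (fun x => (phi x, x \in A')) (fun y => (psi y, y \in B')) A B.
  apply/eqP; rewrite !fibre // -(eqn_pmul2l (isT : 0 < 3)); apply/eqP; case: s.
    by rewrite balA' balB'.
  by rewrite (balancedD A'A) // (balancedD B'B) // !cardsDS // eqAB eqAB'.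
exists f; split=> //; last by move=> x /fcol[].
apply/eqP; rewrite eqEcard card_in_imset ?eqAB' ?leqnn ?andbT.
  apply/subsetP => _ /imsetP[x xA' ->]; have xA := subsetP A'A x xA'.
  by have [_ ->] := fcol x xA.
by apply: sub_in2 injf; apply/subsetP.
Qed.

Lemma rainbow_KTS_containing_transport (P Q : finType) (phi : P -> 'I_3)
    (psi : Q -> 'I_3) (B : {set {set P}}) R (X U : {set Q}) :
  kirkman_triple_system [set: P] B R -> rainbow_colouring [set: P] B R phi ->
  has_rainbow_subsystem [set: P] B R phi #|U| ->
  U \subset X -> U != set0 -> #|P| = #|X| -> balanced psi X -> balanced psi U ->
  rainbow_KTS_containing psi X U.
Proof.
move=> kts rbw [X' [B' [R' [sub cardX' rbw']]]] UX /set0Pn[u _] cardP balX balU.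
have [[_ bal _] [_ bal' _]] := (rbw, rbw').
rewrite -cardsT in cardP.
have [f [injf <- <- fcol]] :=
  exists_balanced_bijection u (subsetT X') UX cardP cardX' bal bal' balX balU.
apply: (rainbow_KTS_containing_image _ (fun x => fcol x (in_setT x))).
  by move=> x y; apply: injf.
by exists B, R, B', R'.
Qed.

Definition tripled (V : finType) (X : {set V}) : {set V * 'I_3} :=
  setX X [set: 'I_3].

Definition raised_level (V : finType) (z : V) (i : 'I_3) (x : V) : 'I_3 :=
  if x == z then ordS i else i.

Definition lift_block (V : finType) (b : {set V}) (z : V) (i : 'I_3) :
    {set V * 'I_3} :=
  [set (x, raised_level z i x) | x in b].

(* The parallel class is selected by the position d of the raised point of each
   block in the enumeration of that block. *)
Definition lift_class (V : finType) (F : {set {set V}}) (d : 'I_3) :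
    {set {set V * 'I_3}} :=
  \bigcup_(b in F) [set lift_block b z i |
    z in [set z in b | index z (enum b) == d], i in [set: 'I_3]].

Lemma ordS3_neq (i : 'I_3) : ordS i != i.
Proof. by case: i => [[|[|[|]]]]. Qed.

Lemma ordS3_cases (i j : 'I_3) : [\/ j = i, j = ordS i | i = ordS j].
Proof.
by case: i j => [[|[|[|i]]] // ?] [[|[|[|j]]] // ?];
  first [by apply: Or31; apply: val_inj | by apply: Or32; apply: val_inj
        |by apply: Or33; apply: val_inj].
Qed.

Section TripledSets.
Variable V : finType.
Implicit Types (X Y : {set V}) (G : {set {set V}}).

Lemma in_tripled X p : (p \in tripled X) = (p.1 \in X).
Proof. by case: p => x i; rewrite in_setX inE andbT. Qed.

Lemma tripledU X Y : tripled (X :|: Y) = tripled X :|: tripled Y.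
Proof. by apply/setP => p; rewrite !(inE, in_tripled). Qed.

Lemma tripledD X Y : tripled (X :\: Y) = tripled X :\: tripled Y.
Proof. by apply/setP => p; rewrite !(inE, in_tripled). Qed.

Lemma tripledC X : tripled (~: X) = ~: tripled X.
Proof. by apply/setP => p; rewrite !(inE, in_tripled). Qed.

Lemma card_tripled X : #|tripled X| = 3 * #|X|.
Proof. by rewrite cardsX cardsT card_ord mulnC. Qed.

Lemma balanced_tripled X : balanced snd (tripled X).
Proof.
move=> c; rewrite card_tripled; congr (3 * _).
rewrite -(card_imset X (f := fun x => (x, c))) => [|x y [] //].
apply: eq_card => -[x i]; rewrite inE in_tripled /=.
by apply/andP/imsetP => [[xX /eqP <-]|[y yX [-> ->]]]; [exists x|].
Qed.

Lemma partition_tripled G X :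
  partition G X -> partition [set tripled g | g in G] (tripled X).
Proof.
move=> GX; apply/and3P; split.
- apply/eqP/setP => p; rewrite in_tripled cover_imset -(cover_partition GX).
  apply/bigcupP/bigcupP => -[g gG pg]; exists g => //;
    by rewrite in_tripled in pg *.
- apply: trivIset_of_block_inj => p _ _ /imsetP[g gG ->] /imsetP[h hG ->].
  rewrite !in_tripled => pg ph.
  by rewrite (partition_block_inj GX gG hG pg ph).
- apply/imsetP => -[g gG /setP E]; have /set0Pn[x xg] := partition_neq0 GX gG.
  by have := E (x, ord0); rewrite in_tripled inE xg.
Qed.

End TripledSets.

Section LiftedBlocks.
Variable V : finType.
Implicit Types (x y z : V) (b : {set V}) (F : {set {set V}}) (d i k l : 'I_3).

Lemma mem_lift_block b z i x k :
  ((x, k) \in lift_block b z i) = (x \in b) && (k == raised_level z i x).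
Proof.
apply/imsetP/andP => [[y yb [-> ->]]|[xb /eqP->]]; first by [].
by exists x.
Qed.

Lemma lift_block_base b z i p : p \in lift_block b z i -> p.1 \in b.
Proof. by case/imsetP=> x xb ->. Qed.

Lemma card_lift_block b z i : #|lift_block b z i| = #|b|.
Proof. by rewrite card_imset // => x y []. Qed.

Lemma fst_lift_block b z i : fst @: lift_block b z i = b.
Proof. by rewrite -imset_comp -[RHS]imset_id; apply: eq_imset. Qed.

Lemma raised_level_inj z x : injective (raised_level z ^~ x).
Proof.
by move=> i j; rewrite /raised_level; case: ifP => // _; apply: ordS_inj.
Qed.

Lemma lift_block_polychromatic b z i :
  1 < #|b| -> z \in b -> lift_block b z i \in polychromatic snd.
Proof.
move=> b1 zb; have /card_gt0P[y] : 0 < #|b :\ z|.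
  by have := cardsD1 z b; rewrite zb; lia.
move=> /setD1P[yz yb]; rewrite inE; apply/card_gt1P; exists (ordS i), i.
split; last exact: ordS3_neq.
  apply/imsetP; exists (z, ordS i) => //.
  by rewrite mem_lift_block zb /raised_level !eqxx.
apply/imsetP; exists (y, i) => //.
by rewrite mem_lift_block yb /raised_level (negbTE yz) eqxx.
Qed.

Lemma exists_raised_levels b x y k l :
  #|b| = 3 -> x \in b -> y \in b -> x != y ->
  exists z i, [/\ z \in b, raised_level z i x = k & raised_level z i y = l].
Proof.
move=> b3 xb yb xy; rewrite /raised_level.
have yx : (y == x) = false by rewrite eq_sym (negbTE xy).
case: (ordS3_cases k l) => ->.
- have /card_gt0P[z] : 0 < #|b :\ x :\ y|.
    have := card_triple_setD1 b3 xb; have := cardsD1 y (b :\ x).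
    by rewrite !inE yb yx => ->; lia.
  rewrite !inE => /and3P[zy zx zb]; exists z, k.
  by rewrite ![_ == z]eq_sym (negbTE zy) (negbTE zx).
- by exists y, k; rewrite (negbTE xy) eqxx.
- by exists x, l; rewrite yx eqxx.
Qed.

(* By the previous lemma this map from nine pairs to nine pairs is onto. *)
Lemma raised_levels_inj b x y :
  #|b| = 3 -> x \in b -> y \in b -> x != y ->
  {in tripled b &, injective
    (fun p => (raised_level p.1 p.2 x, raised_level p.1 p.2 y))}.
Proof.
move=> b3 xb yb xy; apply/imset_injP; rewrite card_tripled b3.
set image := imset _ _; suff -> : image = setT.
  by rewrite cardsT card_prod card_ord.
apply/setP => -[k l]; rewrite inE; apply/imsetP.
have [z [i [zb <- <-]]] := exists_raised_levels k l b3 xb yb xy.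
by exists (z, i); rewrite // in_tripled.
Qed.

Lemma lift_block_inj b x y k l z z' i i' :
  #|b| = 3 -> x != y -> z \in b -> z' \in b ->
  (x, k) \in lift_block b z i -> (y, l) \in lift_block b z i ->
  (x, k) \in lift_block b z' i' -> (y, l) \in lift_block b z' i' ->
  (z, i) = (z', i').
Proof.
rewrite !mem_lift_block => b3 xy zb zb' /andP[xb /eqP->] /andP[yb /eqP->].
move=> /andP[_ /eqP ex] /andP[_ /eqP ey].
by apply: (raised_levels_inj b3 xb yb xy); rewrite ?in_tripled //= ex ey.
Qed.

Lemma lift_classP F d c :
  reflect (exists b z i, [/\ b \in F, z \in b, index z (enum b) = d
                          & c = lift_block b z i])
          (c \in lift_class F d).
Proof.
apply: (iffP bigcupP) => [[b bF /imset2P[z i /setIdP[zb /eqP zd] _ ->]]|].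
  by exists b, z, i.
case=> b [z [i [bF zb zd ->]]]; exists b => //; apply/imset2P.
by exists z i; rewrite ?inE ?zb ?zd /=.
Qed.

Lemma exists_lift_block F b d :
  b \in F -> #|b| = 3 ->
  exists2 z, z \in b & forall i, lift_block b z i \in lift_class F d.
Proof.
move=> bF b3; have cardb : d < #|b| by rewrite b3.
pose z := enum_val (Ordinal cardb); exists z => [|i]; first exact: enum_valP.
apply/lift_classP; exists b, z, i; split; rewrite ?enum_valP //.
by rewrite /z /enum_val index_uniq ?enum_uniq -?cardE.
Qed.

Lemma partition_lift_class F (X : {set V}) d :
  partition F X -> {in F, forall b : {set V}, #|b| = 3} ->
  partition (lift_class F d) (tripled X).
Proof.
move=> FX F3; apply/and3P; split.
- apply/eqP/setP => -[x k]; rewrite in_tripled /=.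
  apply/bigcupP/idP => [[c]|xX].
    case/lift_classP=> b [z [i [bF _ _ ->]]] /lift_block_base.
    exact: partition_mem FX bF.
  have [b bF xb] := partition_exists_block FX xX.
  have [z _ lift_z] := exists_lift_block d bF (F3 b bF).
  exists (lift_block b z (if x == z then ord_pred k else k)) => //.
  rewrite mem_lift_block xb /raised_level.
  by case: (x == z); rewrite ?ord_predK /=.
- apply: trivIset_of_block_inj => -[x k] c c'.
  move=> /lift_classP[b [z [i [bF zb zd ->]]]].
  move=> /lift_classP[b' [z' [i' [bF' zb' zd' ->]]]] xc xc'.
  have Eb : b = b'.
    apply: partition_block_inj FX bF bF' _ _;
      [exact: lift_block_base xc|exact: lift_block_base xc'].
  move: xc xc' zb' zd'; rewrite -Eb.
  rewrite !mem_lift_block => /andP[_ /eqP->] /andP[_ /eqP +] zb' zd'.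
  have <- : z = z'.
    by apply: (index_inj z) (etrans zd (esym zd')); rewrite mem_enum.
  by move/raised_level_inj->.
- apply/lift_classP => -[b [z [i [bF _ _ /esym/eqP]]]].
  by rewrite -cards_eq0 card_lift_block F3.
Qed.

End LiftedBlocks.

Section TripledFrame.
Variables (V : finType) (X : {set V}) (G B : {set {set V}}).
Variable R : {set {set {set V}}}.
Hypothesis frame : kirkman_frame X G B R.

Definition lifted_classes : {set {set {set V * 'I_3}}} :=
  [set lift_class F d | F in R, d in [set: 'I_3]].

Lemma lifted_blockP c :
  reflect (exists b z i, [/\ b \in B, z \in b & c = lift_block b z i])
          (c \in cover lifted_classes).
Proof.
have [[_ tB _ _] RB _] := frame; apply: (iffP bigcupP).
  case=> _ /imset2P[F d FR _ ->] /lift_classP[b [z [i [bF zb _ ->]]]].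
  by exists b, z, i; split=> //; apply: partition_mem RB FR bF.
case=> b [z [i [bB zb ->]]]; have [F FR bF] := partition_exists_block RB bB.
have zd : index z (enum b) < 3.
  by rewrite -(tB b bB).2 cardE index_mem mem_enum.
exists (lift_class F (Ordinal zd)).
  by apply/imset2P; exists F (Ordinal zd).
by apply/lift_classP; exists b, z, i.
Qed.

Lemma lifted_in_unique_block x y k l :
  x != y -> in_unique_block B x y ->
  in_unique_block (cover lifted_classes) (x, k) (y, l).
Proof.
have [[_ tB _ _] _ _] := frame.
move=> xy [b [[bB [xb yb]] uniq]]; have [_ b3] := tB b bB.
have [z [i [zb ex ey]]] := exists_raised_levels k l b3 xb yb xy.
have xc : (x, k) \in lift_block b z i by rewrite mem_lift_block xb ex eqxx.
have yc : (y, l) \in lift_block b z i by rewrite mem_lift_block yb ey eqxx.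
exists (lift_block b z i); split.
  by split=> //; apply/lifted_blockP; exists b, z, i.
move=> _ [/lifted_blockP[b' [z' [i' [bB' zb' ->]]]] [xc' yc']].
have Eb : b = b'.
  by apply: uniq; rewrite (lift_block_base xc') (lift_block_base yc').
rewrite -Eb in zb' xc' yc' *.
by have [-> ->] := lift_block_inj b3 xy zb zb' xc yc xc' yc'.
Qed.

Lemma tripled_GDD3 :
  GDD3 (tripled X) [set tripled g | g in G] (cover lifted_classes).
Proof.
have [[GX tB uB gB] _ _] := frame; split; first exact: partition_tripled.
- move=> _ /lifted_blockP[b [z [i [/tB[/subsetP bX b3] _ ->]]]].
  rewrite card_lift_block; split=> //; apply/subsetP => p.
  by rewrite in_tripled => /lift_block_base/bX.
- move=> _ _ [x k] [y l] /imsetP[g gG ->] /imsetP[h hG ->] gh.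
  rewrite !in_tripled /= => xg yh.
  have {}gh : g != h by apply: contra_neq gh => ->.
  apply: lifted_in_unique_block (uB g h x y gG hG gh xg yh).
  apply: contra_neq gh => E.
  by apply: (partition_block_inj GX gG hG xg); rewrite E.
- move=> _ _ /lifted_blockP[b [z [i [bB _ ->]]]] /imsetP[g gG ->].
  rewrite -(card_in_imset (f := fst)); last first.
    move=> [x k] [y l] /setIP[+ _] /setIP[+ _] /= E.
    by rewrite !mem_lift_block E => /andP[_ /eqP->] /andP[_ /eqP->].
  apply: leq_trans (gB b g bB gG); apply/subset_leq_card/subsetP => x.
  case/imsetP=> p; rewrite inE in_tripled => /andP[/lift_block_base pb pg] ->.
  by rewrite inE pb.
Qed.

Lemma lift_class_inj F F' d d' c :
  F \in R -> F' \in R -> c \in lift_class F d -> c \in lift_class F' d' ->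
  F = F' /\ d = d'.
Proof.
have [[_ tB _ _] RB _] := frame.
move=> FR FR' /lift_classP[b [z [i [bF zb zd ->]]]].
move=> /lift_classP[b' [z' [i' [bF' zb' zd' E]]]].
have Eb : b = b' by rewrite -(fst_lift_block b z i) E fst_lift_block.
rewrite -Eb in bF' zb' zd' E.
split; first exact: partition_block_inj RB FR FR' bF bF'.
have b3 : #|b| = 3 := (tB b (partition_mem RB FR bF)).2.
have /card_gt1P[x [y [xb yb xy]]] : 1 < #|b| by rewrite b3.
apply: val_inj; rewrite /= -zd -zd'.
have in_lift w : w \in b -> (w, raised_level z i w) \in lift_block b z i.
  by rewrite mem_lift_block eqxx andbT.
suff [-> _] : (z, i) = (z', i') by [].
apply: lift_block_inj b3 xy zb zb' (in_lift x xb) (in_lift y yb) _ _;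
  by rewrite -E in_lift.
Qed.

Lemma tripled_kirkman_frame :
  kirkman_frame (tripled X) [set tripled g | g in G]
    (cover lifted_classes) lifted_classes.
Proof.
have [[_ tB _ _] RB RG] := frame.
have lift_partition F d : F \in R ->
    exists2 g, g \in G & partition (lift_class F d) (tripled (X :\: g)).
  move=> FR; have [g gG FX] := RG F FR; exists g => //.
  by apply: partition_lift_class FX _ => b /(partition_mem RB FR)/tB[].
split; first exact: tripled_GDD3.
  apply/and3P; split=> //.
    apply: trivIset_of_block_inj => c D D'.
    move=> /imset2P[F d FR _ ->] /imset2P[F' d' FR' _ ->] cF cF'.
    by have [-> ->] := lift_class_inj FR FR' cF cF'.
  apply/imset2P => -[F d FR _ E]; have /set0Pn[b bF] := partition_neq0 RB FR.
  have [_ b3] := tB b (partition_mem RB FR bF).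
  have [z _ /(_ ord0)] := exists_lift_block d bF b3.
  by rewrite -E inE.
move=> _ /imset2P[F d FR _ ->]; have [g gG Fpart] := lift_partition F d FR.
exists (tripled g); first exact: imset_f.
by rewrite -tripledD.
Qed.

Lemma lifted_blocks_three_coloured : three_colouring (cover lifted_classes) snd.
Proof.
have [[_ tB _ _] _ _] := frame.
apply/three_colouringP/subsetP => _ /lifted_blockP[b [z [i [/tB[_ b3] zb ->]]]].
by apply: lift_block_polychromatic; rewrite ?b3.
Qed.

End TripledFrame.

Lemma setC_imset_inr (S T : finType) :
  ~: (inr @: [set: T]) = inl @: [set: S] :> {set S + T}.
Proof.
apply/setP => -[x|y]; rewrite inE imset_f //; first by apply/imsetP => -[].
by apply/esym/negbTE/imsetP => -[].
Qed.

Lemma card_imset_inlU (S T : finType) (A : {set S}) (B : {set T}) :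
  #|(inl @: A :|: inr @: B : {set S + T})| = #|A| + #|B|.
Proof.
rewrite cardsU disjoint_setI0; last first.
  by apply/pred0P => -[x|y]; apply/andP => -[/imsetP[? _ ?] /imsetP[? _ ?]].
by rewrite cards0 subn0 !card_imset // => x y [].
Qed.

Definition rainbow_KTS_of_orders (n w : nat) : Prop :=
  exists (P : finType) (B : {set {set P}}) (R : {set {set {set P}}})
      (phi : P -> 'I_3),
    [/\ #|P| = n, kirkman_triple_system [set: P] B R,
        rainbow_colouring [set: P] B R phi
      & has_rainbow_subsystem [set: P] B R phi w].

Lemma rainbow_KTS_of_kirkman_frame (V W : finType) (G B : {set {set V}})
    (R : {set {set {set V}}}) :
  kirkman_frame [set: V] G B R -> G != set0 -> 0 < #|W| ->
  {in G, forall g : {set V},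
    rainbow_KTS_of_orders (3 * #|g| + 3 * #|W|) (3 * #|W|)} ->
  has_rainbow_KTS snd [set: (V + W) * 'I_3].
Proof.
move=> frame /set0Pn[g gG] W0 fills.
pose U : {set V + W} := inr @: [set: W].
have cardU : #|tripled U| = 3 * #|W|.
  by rewrite card_tripled card_imset ?cardsT // => x y [].
have U0 : tripled U != set0 by rewrite -card_gt0 cardU muln_gt0.
have inl_inj : injective (inl : V -> V + W) by move=> x y [].
have frame' := kirkman_frame_image inl_inj frame.
have frame3 := tripled_kirkman_frame frame'.
rewrite -setC_imset_inr tripledC in frame3.
apply: (fill_kirkman_frame frame3 (lifted_blocks_three_coloured frame') U0).
  by apply/set0Pn; exists (tripled (inl @: g)); rewrite !imset_f.
move=> _ /imsetP[_ /imsetP[h hG ->] ->]; rewrite -tripledU.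
have [P [? [? [phi [cardP kts rbw sub]]]]] := fills h hG.
apply: (rainbow_KTS_containing_transport kts rbw); rewrite ?cardU //.
- by rewrite tripledU subsetUr.
- by rewrite cardP card_tripled card_imset_inlU cardsT mulnDr.
- exact: balanced_tripled.
- exact: balanced_tripled.
Qed.

Lemma rainbow_subsystem_dvdn (P : finType) (X : {set P}) (B : {set {set P}})
    (R : {set {set {set P}}}) (phi : P -> 'I_3) (w : nat) :
  has_rainbow_subsystem X B R phi w -> 3 %| w.
Proof.
by case=> X' [B' [R' [_ <- [_ /(_ ord0) <- _]]]]; apply: dvdn_mulr.
Qed.

Theorem theorem3p4 (v w : nat) (T : seq nat) (hv : 0 < v) (hw : 0 < w)
    (hframe : exists (V : finType) (G B : {set {set V}})
                (R : {set {set {set V}}}),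
        [/\ #|V| = v, kirkman_frame [set: V] G B R
          & perm_eq (group_type G) T])
    (hfill : forall t, t \in T ->
        exists (P : finType) (B : {set {set P}}) (R : {set {set {set P}}})
               (phi : P -> 'I_3),
        [/\ #|P| = 3 * t + w,
            kirkman_triple_system [set: P] B R,
            rainbow_colouring [set: P] B R phi
          & has_rainbow_subsystem [set: P] B R phi w]) :
  exists (P : finType) (B : {set {set P}}) (R : {set {set {set P}}}),
    [/\ #|P| = 3 * v + w,
        kirkman_triple_system [set: P] B R
      & exists phi : P -> 'I_3, rainbow_colouring [set: P] B R phi].
Proof.
case: hframe => V [G [B [R [cardV frame typeT]]]].
have [[GV _ _ _] _ _] := frame.
have groupT g : g \in G -> #|g| \in T.
  by move=> gG; rewrite -(perm_mem typeT) map_f ?mem_enum.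
have /card_gt0P[x0 _] : 0 < #|V| by rewrite cardV.
have [g0 g0G _] := partition_exists_block GV (in_setT x0).
have [? [? [? [? [_ _ _ /rainbow_subsystem_dvdn/dvdnP[m wE]]]]]] :=
  hfill _ (groupT g0 g0G).
rewrite mulnC in wE.
have [|||B1 [R1 [kts rbw]]] := rainbow_KTS_of_kirkman_frame (W := 'I_m) frame.
- by apply/set0Pn; exists g0.
- by rewrite card_ord; lia.
- by move=> g /groupT/hfill; rewrite card_ord -wE.
exists _, B1, R1; split=> //; last by exists snd.
by rewrite card_prod card_sum !card_ord cardV wE mulnC mulnDr.
Qed.
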